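(* Suppose $\varsigma_*<\infty$ and that the utility condition, the bounded-profit condition, the Leibniz condition, the boundedness condition, the $\Omega$-product condition and the vanishing condition (all spelled out in the context) hold. Then $\varsigma_*\mathbf{1}=(\varsigma_*,\dots,\varsigma_* )$ is a solution of the variational inequality: find $\mathbf{p}\in[0,\varsigma_*]^J$ such that $(\tilde\nabla\hat\pi)(\mathbf{p})^\top(\mathbf{p}-\mathbf{q})\ge 0$ for all $\mathbf{q}\in[0,\varsigma_*]^J$.
   Context: Products are indexed by $\mathcal{J}=\{1,\dots,J\}$, partitioned into nonempty sets $\mathcal{J}_1,\dots,\mathcal{J}_F$ (the products of firms $1,\dots,F$); $f(j)$ is the firm with $j\in\mathcal{J}_{f(j)}$. $\mathcal{P}=[0,\infty)$; unit costs are $\mathbf{c}\in\mathcal{P}^J$. $(\mathcal{T},\mu)$ is a probability space of consumer characteristics $\theta$ (all functions of $\theta$ are measurable), and $\vartheta:\mathcal{T}\to\mathbb{R}$. Product $j$ has utility $u_j:\mathcal{T}\times\mathcal{P}\to[-\infty,\infty)$. Utility condition: $u_j(\theta,p)=w_j(\theta,p)+v_j(\theta)$ with $v_j:\mathcal{T}\to\mathbb{R}$, and there is $\varsigma:\mathcal{T}\to(0,\infty]$ such that for all $j$ and $\mu$-a.e. $\theta$: (a) $w_j(\theta,\cdot)$ is finite, continuously differentiable and strictly decreasing on $(0,\varsigma(\theta))$ with negative derivative $(Dw_j)(\theta,\cdot)<0$; (b) $w_j(\theta,p)=-\infty$ for $p\ge\varsigma(\theta)$; (c) $w_j(\theta,p)\downarrow-\infty$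 as $p\uparrow\varsigma(\theta)$. Put $\varsigma_*=\operatorname{ess\,sup}_\mu\varsigma$. Logit and mixed logit probabilities (with $e^{-\infty}=0$): $P_j^L(\theta,\mathbf{p})=e^{u_j(\theta,p_j)}/(e^{\vartheta(\theta)}+\sum_{k=1}^J e^{u_k(\theta,p_k)})$, $P_j(\mathbf{p})=\int P_j^L(\theta,\mathbf{p})\,d\mu(\theta)$. Let $\mathcal{L}(p)=\{\theta:\varsigma(\theta)>p\}$, $\lambda_j(\mathbf{p})=\int_{\mathcal{L}(p_j)}(Dw_j)(\theta,p_j)P_j^L(\theta,\mathbf{p})\,d\mu$, $\gamma_{j,k}(\mathbf{p})=\int_{\mathcal{L}(p_j)\cap\mathcal{L}(p_k)}P_j^LP_k^L(\theta,\mathbf{p})(Dw_k)(\theta,p_k)\,d\mu$. $\Lambda=\operatorname{diag}(\lambda_j)$; $\tilde\Gamma$ has entries $\gamma_{j,k}$ if $f(j)=f(k)$ and $0$ otherwise; $\tilde\Omega(\mathbf{p})=\Lambda(\mathbf{p})^{-1}\tilde\Gamma(\mathbf{p})^\top$. Bounded-profit condition: for every $j$ there are $r_j:\mathcal{T}\to(1,\infty)$ and $\bar p_j:\mathcal{T}\to\mathcal{P}$ with $\sup\{p\,\mu(\{\bar p_j>p\}):p\in(0,\varsigma_* )\}<\infty$ and, for $\mu$-a.e. $\theta$, $u_j(\theta,p)\le -r_j(\theta)\log p+\vartheta(\theta)$ for all $p\ge\bar p_j(\theta)$. Leibniz condition: for every $k$, with $\psi_k(\theta,p)=|(Dw_k)(\theta,p)|\,e^{u_k(\theta,p)}/(e^{\vartheta(\theta)}+e^{u_k(\theta,p)})$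 if $p<\varsigma(\theta)$ and $\psi_k(\theta,p)=0$ if $p\ge\varsigma(\theta)$: $\psi_k(\theta,\cdot)$ is continuous on $(0,\varsigma_* )$ for $\mu$-a.e. $\theta$, and for every $p\in(0,\varsigma_* )$ there is a $\mu$-integrable $\varphi\ge0$ with $\psi_k(\theta,p')\le\varphi(\theta)$ for all $p'$ in a neighborhood of $p$. Boundedness condition: $\sup\{\|\Lambda(\mathbf{p})^{-1}\mathbf{P}(\mathbf{p})\|_\infty:\mathbf{p}\in(0,\varsigma_* )^J\}<\infty$ and $\sup\{\|\tilde\Omega(\mathbf{p})\|_\infty:\mathbf{p}\in(0,\varsigma_* )^J\}<1$. $\Omega$-product condition: $\sup\{\|\tilde\Omega(\mathbf{p})(\mathbf{p}-\mathbf{c})\|_\infty:\mathbf{p}\in(0,\varsigma_* )^J\}<\infty$. Vanishing condition: for every $k$, $p\,\psi_k(\theta,p)\to0$ as $p\uparrow\varsigma(\theta)$ for $\mu$-a.e. $\theta$, and there are $M<\infty$, $\bar p_k\in[0,\varsigma_* )$ with $p\int\psi_k(\theta,p)\,d\mu(\theta)\le M$ for all $p\in(\bar p_k,\varsigma_* )$. Profits: $\hat\pi_f(\mathbf{p})=\sum_{j\in\mathcal{J}_f}P_j(\mathbf{p})(p_j-c_j)$. The combined gradient $(\tilde\nabla\hat\pi)(\mathbf{p})\in\mathbb{R}^J$ has components $(D_k\hat\pi_{f(k)})(\mathbf{p})$, given (including at boundary prices) by the formula $(D_k\hat\pi_{f(k)})(\mathbf{p})=\lambda_k(\mathbf{p})(p_k-c_k)-\sum_{j\in\mathcal{J}_{f(k)}}\gamma_{j,k}(\mathbf{p})(p_j-c_j)+P_k(\mathbf{p})$.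 *)

(* Defs.v *)
From HB Require Import structures.
From mathcomp Require Import all_boot all_order all_algebra.
From mathcomp Require Import all_classical all_reals all_analysis.
From mathcomp Require Import measurable_realfun ess_sup_inf.

Set Implicit Arguments.
Unset Strict Implicit.
Unset Printing Implicit Defensive.

Import Order.TTheory GRing.Theory Num.Theory.
Import numFieldNormedType.Exports.
Local Open Scope classical_set_scope.
Local Open Scope ring_scope.

(* The filter "p increases to x", for a real or infinite upper end x.  The case
   x = -oo is junk: x is always positive below. *)
Definition approach_left (R : realType) (x : \bar R) : set_system R :=
  match x with
  | s%:E => at_left s
  | +oo%E => pinfty_nbhs R
  | -oo%E => [set: set R]
  end.

(* Maximal absolute row sum, i.e. the matrix norm induced by the sup norm; on
   a column vector it is the sup norm itself.  The library norm `|A| is the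
   largest absolute entry, which differs when A has several columns. *)
Definition norm_infty (R : realType) (m n : nat) (A : 'M[R]_(m, n)) : R :=
  \big[Num.max/0]_(i < m) \sum_(j < n) `|A i j|.

Definition closed_box (R : realType) (n : nat) (b : \bar R) : set 'cV[R]_n :=
  [set p | forall j, 0 <= p j ord0 /\ ((p j ord0)%:E <= b)%E].

Definition open_box (R : realType) (n : nat) (b : \bar R) : set 'cV[R]_n :=
  [set p | forall j, 0 < p j ord0 /\ ((p j ord0)%:E < b)%E].

Definition VI_solution (R : realType) (n : nat) (G : 'cV[R]_n -> 'cV[R]_n)
    (b : \bar R) (p : 'cV[R]_n) : Prop :=
  closed_box b p /\
  forall q, closed_box b q -> 0 <= ((G p)^T *m (p - q)) ord0 ord0.

Section MixedLogit.
Context {R : realType} {d : measure_display} {T : measurableType d}.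
Variables (mu : probability T R) (J F : nat).
Variables (f : 'I_J -> 'I_F) (c : 'cV[R]_J).
(* Prices are the nonnegative reals.  Utilities are functions on all of R, of
   which only the values at nonnegative prices are meaningful. *)
Variables (vtheta : T -> R) (u w : 'I_J -> T -> R -> \bar R).
Variables (v : 'I_J -> T -> R) (vsig : T -> \bar R).

Definition vsig_sup : \bar R := ess_sup mu vsig.

Definition Dw (j : 'I_J) (theta : T) (p : R) : R :=
  derive1 (fun x => fine (w j theta x)) p.

Definition calL (p : R) : set T := [set theta | (p%:E < vsig theta)%E].

(* e^u as a real number (u < +oo), with e^{-oo} = 0. *)
Definition expu (j : 'I_J) (theta : T) (p : R) : R :=
  fine (expeR (u j theta p)).

Definition PL (j : 'I_J) (theta : T) (p : 'cV[R]_J) : R :=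
  expu j theta (p j ord0) /
  (expR (vtheta theta) + \sum_(k < J) expu k theta (p k ord0)).

Definition P (j : 'I_J) (p : 'cV[R]_J) : R :=
  (\int[mu]_(theta in [set: T]) PL j theta p)%R.

Definition Pvec (p : 'cV[R]_J) : 'cV[R]_J := \col_j P j p.

(* At interior prices the integrands of lambda and gamma are dominated by psi,
   hence integrable under the Leibniz condition. *)
Definition lambda (j : 'I_J) (p : 'cV[R]_J) : R :=
  (\int[mu]_(theta in calL (p j ord0)) (Dw j theta (p j ord0) * PL j theta p))%R.

Definition gamma (j k : 'I_J) (p : 'cV[R]_J) : R :=
  (\int[mu]_(theta in calL (p j ord0) `&` calL (p k ord0))
     (PL j theta p * PL k theta p * Dw k theta (p k ord0)))%R.

Definition Lambda (p : 'cV[R]_J) : 'M[R]_J := diag_mx (\row_j lambda j p).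

Definition Gamma_tilde (p : 'cV[R]_J) : 'M[R]_J :=
  \matrix_(j, k) (if f j == f k then gamma j k p else 0).

(* Under the utility condition lambda j p < 0 on the open box, so Lambda p is
   invertible wherever its inverse is used below. *)
Definition Omega_tilde (p : 'cV[R]_J) : 'M[R]_J :=
  invmx (Lambda p) *m (Gamma_tilde p)^T.

Definition profit (g : 'I_F) (p : 'cV[R]_J) : R :=
  \sum_(j < J | f j == g) P j p * (p j ord0 - c j ord0).

(* Component k is the partial derivative in p_k of the profit of firm f k; this
   closed form also defines it at prices on the boundary of the box, where
   partial derivatives need not make sense. *)
Definition combined_gradient (p : 'cV[R]_J) : 'cV[R]_J :=
  \col_k (lambda k p * (p k ord0 - c k ord0)
          - \sum_(j < J | f j == f k) gamma j k p * (p j ord0 - c j ord0)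
          + P k p).

Definition psi (k : 'I_J) (theta : T) (p : R) : R :=
  if (p%:E < vsig theta)%E then
    `|Dw k theta p| * expu k theta p / (expR (vtheta theta) + expu k theta p)
  else 0.

Definition data_measurable : Prop :=
  [/\ measurable_fun [set: T] vtheta,
      measurable_fun [set: T] vsig,
      (forall j, measurable_fun [set: T] (v j)),
      (forall j p, 0 <= p ->
         measurable_fun [set: T] (fun theta => u j theta p) /\
         measurable_fun [set: T] (fun theta => w j theta p)) &
      (forall j p, 0 < p ->
         measurable_fun (calL p) (fun theta => Dw j theta p))].

Definition utility_condition : Prop :=
  [/\ (forall j theta p, 0 <= p ->
         u j theta p = (w j theta p + (v j theta)%:E)%E),
      (forall theta, (0 < vsig theta)%E) &
      forall j, {ae mu, forall theta,
        [/\ (forall p, 0 < p -> (p%:E < vsig theta)%E ->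
               [/\ w j theta p \is a fin_num,
                   derivable (fun x => fine (w j theta x)) p 1,
                   {for p, continuous (Dw j theta)} &
                   Dw j theta p < 0]),
            (forall p q, 0 < p -> p < q -> (q%:E < vsig theta)%E ->
               (w j theta q < w j theta p)%E),
            (forall p, 0 <= p -> (vsig theta <= p%:E)%E ->
               w j theta p = -oo%E) &
            w j theta p @[p --> approach_left (vsig theta)] --> -oo%E]}].

(* lne, unlike ln, satisfies log 0 = -oo, so that at p = 0 the bound is +oo. *)
Definition bounded_profit_condition : Prop :=
  forall j, exists (r : T -> R) (pbar : T -> R),
    [/\ measurable_fun [set: T] r /\ (forall theta, 1 < r theta),
        measurable_fun [set: T] pbar /\ (forall theta, 0 <= pbar theta),
        (ereal_sup [set p%:E * mu [set theta | (p < pbar theta)%R]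
                   | p in [set p : R | (0 < p)%R /\ p%:E < vsig_sup]] < +oo)%E &
        {ae mu, forall theta, forall p, pbar theta <= p ->
          (u j theta p <= - (r theta)%:E * lne p%:E + (vtheta theta)%:E)%E}].

(* The neighborhood does not depend on theta; domination is only required
   almost everywhere, as psi is only controlled almost everywhere. *)
Definition Leibniz_condition : Prop :=
  forall k,
    {ae mu, forall theta, forall p, 0 < p -> (p%:E < vsig_sup)%E ->
      {for p, continuous (psi k theta)}} /\
    forall p, 0 < p -> (p%:E < vsig_sup)%E ->
      exists phi : T -> R,
        [/\ mu.-integrable [set: T] (EFin \o phi),
            (forall theta, 0 <= phi theta) &
            \forall p' \near p,
              {ae mu, forall theta, psi k theta p' <= phi theta}].

Definition boundedness_condition : Prop :=
  (ereal_sup [set (norm_infty (invmx (Lambda p) *m Pvec p))%:E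
             | p in @open_box R J vsig_sup] < +oo)%E /\
  (ereal_sup [set (norm_infty (Omega_tilde p))%:E
             | p in @open_box R J vsig_sup] < 1)%E.

Definition Omega_product_condition : Prop :=
  (ereal_sup [set (norm_infty (Omega_tilde p *m (p - c)))%:E
             | p in @open_box R J vsig_sup] < +oo)%E.

Definition vanishing_condition : Prop :=
  forall k,
    {ae mu, forall theta,
      p * psi k theta p @[p --> approach_left (vsig theta)] --> (0 : R)} /\
    exists M pbar : R,
      [/\ 0 <= pbar, (pbar%:E < vsig_sup)%E &
          forall p, pbar < p -> (p%:E < vsig_sup)%E ->
            (p%:E * \int[mu]_(theta in [set: T]) (psi k theta p)%:E <= M%:E)%E].

End MixedLogit.

(* Main.v *)
(* For almost every consumer the reservation price is at most the top price
   [vsig_sup]. There every utility is [-oo], so each choice probability is zero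
   almost everywhere, and the domains of integration of [lambda] and [gamma] are
   null sets: the combined gradient vanishes at the top corner of the box. *)
Require Import Defs.
From HB Require Import structures.
From mathcomp Require Import all_boot all_order all_algebra.
From mathcomp Require Import all_classical all_reals all_analysis.
From mathcomp Require Import measurable_realfun ess_sup_inf.
Import Order.TTheory GRing.Theory Num.Theory.
Import numFieldNormedType.Exports.
Local Open Scope classical_set_scope.
Local Open Scope ring_scope.

Section AlmostEverywhereZero.
Context {d : measure_display} {T : measurableType d} {R : realType}.
Variable mu : {measure set T -> \bar R}.
Import HBNNSimple.

(* Unlike [ae_eq_integral], this needs no measurability: a nonnegative simple
   function below an almost everywhere zero function is itself zero almost
   everywhere. *)
Lemma integral_ae0 (D : set T) (g : T -> \bar R) :
  {ae mu, forall x, D x -> g x = 0%E} -> (\int[mu]_(x in D) g x = 0)%E.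
Proof.
have ge0_case (h : T -> \bar R) : (forall x, 0 <= h x)%E ->
    {ae mu, forall x, h x = 0%E} -> (\int[mu]_x h x = 0)%E.
  move=> h0 hae; apply/eqP; rewrite eq_le integral_ge0 // andbT.
  rewrite ge0_integralTE //; apply: ub_ereal_sup => _ [k /= kh <-].
  (* The simple function [k] is measurable, so [ae_eq_integral] can be applied to it rather than to
     [h]. *)
  rewrite -integralT_nnsfun (@ae_eq_integral _ _ _ mu setT (cst 0%E)) ?integral0 //.
    exact/measurable_EFinP.
  apply: filterS hae => x hx _ /=; apply/eqP; rewrite eq_le -[X in (_ <= X)%E]hx kh.
  by rewrite lee_fin; exact: fun_ge0.
(* Extension by zero off [D], then splitting into positive and negative parts, leaves two instances
   of [ge0_case]. *)
move=> gae; rewrite integral_mkcond integralE !ge0_case ?sube0 //.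
- apply: filterS gae => x gx; rewrite funenegE /patch.
  by case: ifPn => [/set_mem/gx ->|_]; rewrite oppe0 maxxx.
- apply: filterS gae => x gx; rewrite funeposE /patch.
  by case: ifPn => [/set_mem/gx ->|_]; rewrite maxxx.
Qed.

Lemma Rintegral_ae0 (D : set T) (g : T -> R) :
  {ae mu, forall x, D x -> g x = 0} -> (\int[mu]_(x in D) g x)%R = 0.
Proof.
by move=> gae; rewrite /Rintegral integral_ae0//; apply: filterS gae => x gx /gx ->.
Qed.

End AlmostEverywhereZero.

(** Positive total mass is essential: for the zero measure the essential supremum is -oo. *)
Lemma ess_sup_ge0 d (T : measurableType d) (R : realType)
    (mu : probability T R) (g : T -> \bar R) :
  (forall t, 0 <= g t)%E -> (0 <= ess_sup mu g)%E.
Proof.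
move=> g0; apply: ess_sup_gee; last exact: aeW.
by rewrite (lt_le_trans lte01) // -(probability_setT mu).
Qed.

Theorem proposition5p1 (R : realType) (d : measure_display)
    (T : measurableType d) (mu : probability T R) (J F : nat) (J_gt0 : (0 < J)%N)
    (f : 'I_J -> 'I_F) (f_surj : forall g : 'I_F, exists j : 'I_J, f j = g)
    (c : 'cV[R]_J) (c_ge0 : forall j : 'I_J, 0 <= c j ord0)
    (vtheta : T -> R) (u w : 'I_J -> T -> R -> \bar R)
    (v : 'I_J -> T -> R) (vsig : T -> \bar R)
    (u_lty : forall (j : 'I_J) (theta : T) (p : R), 0 <= p ->
       (u j theta p < +oo)%E)
    (meas : data_measurable vtheta u w v vsig)
    (vsig_sup_lty : (vsig_sup mu vsig < +oo)%E)
    (utility : utility_condition mu u w v vsig)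
    (bounded_profit : bounded_profit_condition mu vtheta u vsig)
    (leibniz : Leibniz_condition mu vtheta u w vsig)
    (boundedness : boundedness_condition mu f vtheta u w vsig)
    (omega_product : Omega_product_condition mu f c vtheta u w vsig)
    (vanishing : vanishing_condition mu vtheta u w vsig) :
  VI_solution (combined_gradient mu f c vtheta u w vsig) (vsig_sup mu vsig)
    (const_mx (fine (vsig_sup mu vsig))).
Proof.
have [uE vsig_gt0 w_ae] := utility.
(* Nonnegativity serves three times: with [vsig_sup_lty] it makes [fine] lossless, it puts the
   corner in the box, and it lets the utility condition be used at price [s]. *)
have vsig_sup_ge0 : (0 <= vsig_sup mu vsig)%E.
  by apply: ess_sup_ge0 => t; exact: ltW.
have vsig_supE : (fine (vsig_sup mu vsig))%:E = vsig_sup mu vsig.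
  by rewrite fineK // ge0_fin_numE.
set s := fine (vsig_sup mu vsig) in vsig_supE *.
have s_ge0 : 0 <= s by rewrite -lee_fin vsig_supE.
have vsig_le : {ae mu, forall t, (vsig t <= s%:E)%E}.
  by rewrite vsig_supE; exact: ess_sup_ge.
have P0 k : P mu vtheta u k (const_mx s) = 0.
  apply: Rintegral_ae0; apply: filterS2 vsig_le (w_ae k) => t vt [_ _ wNy _] _.
  (* Since [v k t] is real, adding it to -oo leaves -oo, which [expeR] sends to 0: the numerator
     vanishes. *)
  by rewrite /PL /expu mxE uE // wNy // addNye /= mul0r.
have lambda0 k : lambda mu vtheta u w vsig k (const_mx s) = 0.
  apply: Rintegral_ae0; apply: filterS vsig_le => t vt.
  (* The premise [calL s t] contradicts [vt], so nothing is asked of the integrand. *)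
  by rewrite /calL /= mxE ltNge vt.
have gamma0 j k : gamma mu vtheta u w vsig j k (const_mx s) = 0.
  apply: Rintegral_ae0; apply: filterS vsig_le => t vt [].
  by rewrite /calL /= mxE ltNge vt.
split=> [j|q _]; first by rewrite mxE vsig_supE.
(* With a zero gradient the inequality is an equality for every [q]. *)
suff -> : combined_gradient mu f c vtheta u w vsig (const_mx s) = 0.
  by rewrite trmx0 mul0mx mxE.
apply/colP => k; rewrite !mxE lambda0 P0 mul0r addr0 big1 ?subr0 // => j _.
by rewrite gamma0 mul0r.
Qed.
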